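(* Let $\varphi\in C(\mathbb{R})$ satisfy: (i) $\sum_{k\in\mathbb{Z}}\varphi(u-k)=1$ for every $u\in\mathbb{R}$; (ii) $M_2(\varphi)<+\infty$ and $\lim_{r\to\infty}\sum_{|u-k|>r}|\varphi(u-k)|(k-u)^2=0$ uniformly with respect to $u\in\mathbb{R}$; (iii) $\sum_{k\in\mathbb{Z}}\varphi(u-k)(k-u)=0$ for every $u\in\mathbb{R}$. Let $\{a_k\}_{k\in\mathbb{Z}}$ and $\{b_k\}_{k\in\mathbb{Z}}$ be two bounded sequences of real numbers for which there exist constants $\alpha\in\mathbb{R}$ and $\Delta^{*}>0$ such that $a_k+b_k=\alpha$ and $b_k-a_k>\Delta^{*}$ for all $k\in\mathbb{Z}$. Let $f\in C(\mathbb{R})$. If $f'(x)$ exists at a point $x\in\mathbb{R}$, then $$\lim_{w\to\infty} w\big[(K_w^{\varphi}f)(x)-f(x)\big]=\frac{\alpha}{2}f'(x).$$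
   Context: $C(\mathbb{R})$ denotes the set of all uniformly continuous and bounded functions $\mathbb{R}\to\mathbb{R}$. For $\nu\ge 0$ the absolute moment of $\varphi$ is $M_\nu(\varphi):=\sup_{u\in\mathbb{R}}\sum_{k\in\mathbb{Z}}|\varphi(u-k)|\,|k-u|^{\nu}$. For $w>0$ and sequences $\{a_k\}_{k\in\mathbb{Z}},\{b_k\}_{k\in\mathbb{Z}}$ with $\Delta_k:=b_k-a_k>0$, the generalized Kantorovich sampling series of $f\in C(\mathbb{R})$ is $$(K_w^{\varphi}f)(x)=\sum_{k=-\infty}^{\infty}\frac{w}{\Delta_k}\,\varphi(wx-k)\int_{\frac{k+a_k}{w}}^{\frac{k+b_k}{w}}f(u)\,du,\qquad x\in\mathbb{R}.$$ *)

(* Defs.v *)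
From HB Require Import structures.
From mathcomp Require Import all_boot all_order all_algebra.
From mathcomp Require Import all_classical all_reals all_analysis.

Set Implicit Arguments.
Unset Strict Implicit.
Unset Printing Implicit Defensive.

Import Order.TTheory GRing.Theory Num.Theory.
Import numFieldNormedType.Exports.

Local Open Scope classical_set_scope.
Local Open Scope ring_scope.

Definition UCB (R : realType) : set (R -> R) :=
  [set f | unif_continuous f /\ bounded_fun f].

(* A series indexed by the integers converges when its two halves, over
   k = 0, 1, 2, ... (Posz) and over k = -1, -2, ... (Negz n = - n.+1), both
   converge; its sum is then the sum of the two limits. *)
Definition zsum (R : realType) (c : int -> R) : R :=
  limn (series (fun n => c (Posz n))) + limn (series (fun n => c (Negz n))).

Definition has_zsum (R : realType) (c : int -> R) (l : R) : Prop :=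
  [/\ cvgn (series (fun n => c (Posz n))),
      cvgn (series (fun n => c (Negz n))) &
      zsum c = l].

(* The powers `^ are real powers, with 0 `^ 0 = 1. *)
Definition abs_moment (R : realType) (nu : R) (phi : R -> R) : \bar R :=
  ereal_sup (range (fun u : R =>
    \esum_(k in [set: int])
      (`|phi (u - k%:~R)| * `|k%:~R - u| `^ nu)%:E)).

Definition moment2_tail (R : realType) (phi : R -> R) (r u : R) : \bar R :=
  \esum_(k in [set k : int | r < `|u - k%:~R|])
    (`|phi (u - k%:~R)| * (k%:~R - u) ^+ 2)%:E.

(* The average over an interval makes sense when a k < b k for all k, w > 0. *)
Definition kantorovich (R : realType) (phi : R -> R) (a b : int -> R)
    (w : R) (f : R -> R) (x : R) : R :=
  zsum (fun k : int =>
    w / (b k - a k) * phi (w * x - k%:~R) *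
    \int[lebesgue_measure]_(u in `[(k%:~R + a k) / w, (k%:~R + b k) / w]) f u).

(* Main.v *)
(* Since f is bounded and differentiable at x, for every e > 0 there is C with
   |f t - f x - f'(x) (t - x)| <= e |t - x| + C (t - x)^2 for all t.
   The mean of the affine part over the k-th interval is
   f x + (f'(x) / w) (k - w x + alpha / 2), because a_k + b_k = alpha, and by
   (i) and (iii) these means sum to f x + alpha f'(x) / (2 w).  The means of
   the error sum to O((e + C / w) / w), because the moments of orders 0 and 2
   are finite. *)
Require Import Defs.
From HB Require Import structures.
From mathcomp Require Import all_boot all_order all_algebra.
From mathcomp Require Import all_classical all_reals all_analysis.
From mathcomp Require Import ring lra zify.

Set Implicit Arguments.
Unset Strict Implicit.

Import Order.TTheory GRing.Theory Num.Theory.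
Import numFieldNormedType.Exports.

Local Open Scope classical_set_scope.
Local Open Scope ring_scope.

(** * Bounded functions and series over the integers *)

Lemma bounded_fun_le (R : realType) (T : Type) (h : T -> R) :
  bounded_fun h -> exists2 B, 0 <= B & forall t, `|h t| <= B.
Proof.
move=> /pinfty_ex_gt0[B B0 hB]; exists B; first exact: ltW.
by move=> t; exact: hB.
Qed.

Lemma sum_le_esum (R : realType) (T : choiceType) (c : T -> R) (s : seq T) :
  uniq s -> ((\sum_(k <- s) c k)%:E <= \esum_(k in [set: T]) (c k)%:E)%E.
Proof.
move=> us; apply: esum_ge; exists [set` s].
  by split => //; exact: finite_seq.
by rewrite -sumEFin -fsbig_seq.
Qed.

Lemma has_zsumD (R : realType) (c d : int -> R) (l m : R) :
  has_zsum c l -> has_zsum d m -> has_zsum (fun k => c k + d k) (l + m).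
Proof.
move=> [cP cN <-] [dP dN <-]; rewrite /has_zsum /zsum; split.
- exact: is_cvg_seriesD cP dP.
- exact: is_cvg_seriesD cN dN.
- rewrite (lim_seriesD cP dP) (lim_seriesD cN dN).
  by rewrite addrACA.
Qed.

Lemma has_zsumZ (R : realType) (a : R) (c : int -> R) (l : R) :
  has_zsum c l -> has_zsum (fun k => a * c k) (a * l).
Proof.
move=> [cP cN <-]; rewrite /has_zsum /zsum; split.
- exact: is_cvg_seriesZ a cP.
- exact: is_cvg_seriesZ a cN.
- rewrite (lim_seriesZ a cP) (lim_seriesZ a cN).
  by rewrite mulrDr.
Qed.

Lemma dominated_series (R : realType) (c d : R ^nat) (M : R) :
  (forall n, `|c n| <= d n) -> (forall n, series d n <= M) ->
  cvgn (series c) /\ `|limn (series c)| <= M.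
Proof.
move=> cd dM.
have ncM n : [normed series c] n <= M.
  by apply: le_trans (dM n); apply: ler_sum => i _; exact: cd.
have cvgc : cvgn [normed series c].
  apply: nondecreasing_is_cvgn.
    by apply: nondecreasing_series => n _ _ /=.
  by exists M => _ [n _ <-].
split; first exact: (normed_cvg (V := R^o)).
apply: le_trans (lim_series_norm (V := R^o) cvgc) _.
by apply: limr_le => //; exact: nearW.
Qed.

(** The hypothesis bounds sums over duplicate-free lists, the form in which a finite moment is
    available. Both [Posz] and [Negz] are injective, so the partial sums of each half are such sums;
    each half contributes one [M]. *)
Lemma dominated_has_zsum (R : realType) (c d : int -> R) (M : R) :
  (forall k, `|c k| <= d k) ->
  (forall s : seq int, uniq s -> \sum_(k <- s) d k <= M) ->
  exists2 l, has_zsum c l & `|l| <= M + M.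
Proof.
move=> cd dM.
have dMh (h : nat -> int) : injective h -> forall n, series (d \o h) n <= M.
  move=> hI n; rewrite seriesEnat /= -(big_map h xpredT d).
  by apply: dM; rewrite map_inj_uniq// iota_uniq.
have [cP lP] := dominated_series (fun n => cd (Posz n))
  (dMh Posz (fun m n (e : Posz m = Posz n) => congr1 absz e)).
(* Since [absz (Negz n)] is [n.+1], [predn] recovers [n]. *)
have [cN lN] := dominated_series (fun n => cd (Negz n))
  (dMh Negz (fun m n (e : Negz m = Negz n) => congr1 (predn \o absz) e)).
exists (zsum c) => //.
by apply: le_trans (ler_normD _ _) _; exact: lerD.
Qed.

(** * Discrete moments of the kernel *)

Lemma sum_mem_le1 (R : numDomainType) (T : eqType) (j : T) (s : seq T) :
  uniq s -> \sum_(k <- s) (k == j)%:R <= 1 :> R.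
Proof.
move=> us; rewrite -natr_sum -big_mkcond sum1_count -/(count_mem j s).
by rewrite count_uniq_mem// lern1; case: (j \in s).
Qed.

(** The weight 1 + s^2, with s = k - u, dominates both the linear and the quadratic part of the
    error, so a single constant, uniform in [u], serves for both. *)
Lemma moment02_bounded (R : realType) (phi : R -> R) :
  bounded_fun phi -> (abs_moment 2 phi < +oo)%E ->
  exists2 M, 0 <= M & forall (u : R) (s : seq int), uniq s ->
    \sum_(k <- s) `|phi (u - k%:~R)| * (1 + (k%:~R - u) ^+ 2) <= M.
Proof.
move=> /bounded_fun_le[B B0 phiB] phi2.
have [M2 M20 hM2] : exists2 M2, 0 <= M2 & forall (u : R) (s : seq int),
    uniq s -> \sum_(k <- s) `|phi (u - k%:~R)| * (k%:~R - u) ^+ 2 <= M2.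
  pose c (u : R) (k : int) := `|phi (u - k%:~R)| * `|k%:~R - u| `^ 2.
  have cM u (s : seq int) : uniq s ->
      ((\sum_(k <- s) c u k)%:E <= abs_moment 2 phi)%E.
    move=> us; apply: le_trans (sum_le_esum (c u) us) _.
    by apply: ereal_sup_ubound; exists u.
  (* The empty sum shows that the moment is nonnegative, so being below +oo makes it finite. *)
  have M2_fin : abs_moment 2 phi \is a fin_num.
    rewrite ge0_fin_numE//; apply: le_trans (cM 0 [::] erefl).
    by rewrite big_nil.
  exists (fine (abs_moment 2 phi)).
    by have := cM 0 [::] erefl; rewrite big_nil -(fineK M2_fin) lee_fin.
  move=> u s us; have := cM u s us; rewrite -{1}(fineK M2_fin) lee_fin.
  apply: le_trans; apply: ler_sum => k _.
  by rewrite /c powR_mulrn// real_normK ?num_real.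
exists (2 * M2 + B * 2) => [|u s us]; first by rewrite addr_ge0// mulr_ge0.
(* Only the two integers around u are at distance less than 1 from u, so the
   zeroth moment is bounded by the second one and the supremum of |phi|. *)
set j := Num.floor u.
have near_int (k : int) :
    1 <= (k%:~R - u) ^+ 2 + ((k == j)%:R + (k == j + 1)%:R).
  have [/eqP _|kj] := boolP (k == j).
    by rewrite addrA addrAC; rewrite lerDr addr_ge0// sqr_ge0.
  have [_|kj1] := boolP (k == j + 1).
    by rewrite add0r lerDr sqr_ge0.
  rewrite !addr0.
  have /andP[ju uj1] := floor_itv u; rewrite -/j in ju uj1.
  have [jk|jk] : (k <= j - 1 \/ j + 2 <= k)%R by lia.
    have : (k%:~R <= (j - 1)%:~R :> R) by rewrite ler_int.
    rewrite intrD in uj1; rewrite intrB; nra.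
  have : ((j + 2)%:~R <= k%:~R :> R) by rewrite ler_int.
  rewrite intrD in uj1; rewrite intrD; nra.
(* With i the sum of the two indicators, [near_int] gives 1 + s^2 <= 2 s^2 + i; the factor |phi| is
   then bounded by [B] in front of i only. *)
apply: (@le_trans _ _ (\sum_(k <- s)
    (2 * (`|phi (u - k%:~R)| * (k%:~R - u) ^+ 2) +
     B * ((k == j)%:R + (k == j + 1)%:R)))).
  apply: ler_sum => k _.
  have := near_int k; set s2 := _ ^+ 2; set i := _%:R + _ => h.
  have i0 : 0 <= i by rewrite addr_ge0.
  have := phiB (u - k%:~R); have := normr_ge0 (phi (u - k%:~R)).
  set p := `|_|; nra.
rewrite big_split/= -!mulr_sumr big_split/=.
by rewrite lerD// ler_wpM2l ?hM2// -[leRHS]/(1 + 1) lerD// sum_mem_le1.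
Qed.

(** * Remainder of [f] at [x] and its averages *)

(** Within a radius r of [x] the difference quotient is [e]-close to the derivative, which gives the
    linear term. Farther away the remainder grows at most linearly, as [f] is bounded, and the
    quadratic term absorbs it. *)
Lemma derivable_quadratic_bound (R : realType) (f : R -> R) (x : R) :
  bounded_fun f -> derivable f x 1 -> forall e, 0 < e ->
  exists2 C, 0 <= C & forall t,
    `|f t - f x - (f^`())%classic x * (t - x)| <=
      e * `|t - x| + C * (t - x) ^+ 2.
Proof.
move=> /bounded_fun_le[B B0 fB] dfx e e0; set d := (f^`())%classic x.
have dfx' : (fun h => h^-1 *: (f (h + x) - f x)) @ 0^' --> d.
  move: dfx; rewrite /d derive1E /derive /derivable.
  set F := fun h => _; rewrite (_ : (fun h => _) = F)//.
  by apply/funext => h; rewrite /F /= [_%:A]mulr1.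
move/cvgrPdist_le : dfx' => /(_ e e0) [r /= r0 hr].
have r_ge0 := ltW r0.
(* This constant makes C s^2 at least 2 B + |d| |s| once |s| / r >= 1: the first summand is
   multiplied by (|s| / r)^2, the second by |s| / r. *)
have C0 : 0 <= 2 * B / r ^+ 2 + `|d| / r.
  by rewrite addr_ge0// divr_ge0// ?mulr_ge0// ?sqr_ge0.
exists (2 * B / r ^+ 2 + `|d| / r) => //.
move=> t; set s := t - x.
(* The limit of the difference quotient says nothing at s = 0. *)
have [s0|s0] := eqVneq s 0.
  have -> : t = x by apply/eqP; rewrite -subr_eq0 -/s s0.
  by rewrite s0 !subrr mulr0 normr0 expr0n !mulr0 subrr normr0 addr0.
have [sr|rs] := ltP `|s| r.
  have := hr s; rewrite /ball_ /= sub0r normrN => /(_ sr s0).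
  rewrite /s subrK -/s distrC => H.
  have -> : f t - f x - d * s = (s^-1 *: (f t - f x) - d) * s.
    by rewrite mulrBl [_ *: _]mulrC mulfVK.
  rewrite normrM; apply: (@le_trans _ _ (e * `|s|)).
    by rewrite ler_wpM2r.
  by rewrite lerDl mulr_ge0 ?sqr_ge0.
apply: (@le_trans _ _ (2 * B + `|d| * `|s|)).
  apply: le_trans (ler_normB _ _) _; rewrite normrM lerD2r.
  by apply: le_trans (ler_normB _ _) _; rewrite mulrDl mul1r lerD.
apply: (@le_trans _ _ ((2 * B / r ^+ 2 + `|d| / r) * s ^+ 2)); last first.
  by rewrite lerDr mulr_ge0// ltW.
have hs : 1 <= `|s| / r by rewrite ler_pdivlMr// mul1r.
rewrite -(real_normK (num_real s)).
have -> : (2 * B / r ^+ 2 + `|d| / r) * `|s| ^+ 2 =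
  2 * B * (`|s| / r) ^+ 2 + `|d| * `|s| * (`|s| / r).
  by field; exact: lt0r_neq0.
apply: lerD.
  by rewrite ler_peMr ?mulr_ge0// expr_ge1// (le_trans _ hs).
by rewrite ler_peMr ?mulr_ge0.
Qed.

(* The affine part integrates to its value at the midpoint of the interval. *)
Lemma itv_average_bound (R : realType) (f : R -> R) (p q x y d K : R) :
  p < q -> continuous f ->
  (forall t, p <= t <= q -> `|f t - y - d * (t - x)| <= K) ->
  `|(q - p)^-1 * (\int[lebesgue_measure]_(t in `[p, q]) f t) -
    (y + d * ((p + q) / 2 - x))| <= K.
Proof.
move=> pq cf hK; set mu := lebesgue_measure.
have cint (g : R -> R) : continuous g -> mu.-integrable `[p, q] (EFin \o g).
  move=> cg; apply: continuous_compact_integrable; first exact: segment_compact.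
  exact: continuous_subspaceT.
pose l (t : R) := y + d * (t - x).
(* A primitive of [l], for the fundamental theorem of calculus. *)
pose L (t : R) := y * t + d * (t - x) ^+ 2 / 2.
have dL (t : R) : is_derive t 1 L (l t).
  rewrite /L /l; apply: is_derive_eq.
  rewrite /GRing.scale /=; lra.
have cl : continuous l.
  move=> t; apply: cvgD; first exact: cvg_cst.
  by apply: cvgM; [exact: cvg_cst|apply: cvgB; [exact: cvg_id|exact: cvg_cst]].
have cL : continuous L.
  by move=> t; apply/differentiable_continuous/derivable1_diffP.
have intl : \int[mu]_(t in `[p, q]) l t = (q - p) * (y + d * ((p + q) / 2 - x)).
  rewrite /Rintegral (@continuous_FTC2 _ l L)//.
  - by rewrite /= /L; field.
  - exact: continuous_subspaceT.
  - split=> [t _| |]; first by have [] := dL t.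
      exact/cvg_at_right_filter/cL.
    exact/cvg_at_left_filter/cL.
  - by move=> t _; rewrite derive1E; apply: derive_val.
have qp0 : 0 < q - p by rewrite subr_gt0.
have -> : (q - p)^-1 * (\int[mu]_(t in `[p, q]) f t) -
    (y + d * ((p + q) / 2 - x)) =
    (q - p)^-1 * \int[mu]_(t in `[p, q]) (f t - l t).
  by rewrite RintegralB ?cint// intl [RHS]mulrBr mulKf// lt0r_neq0.
rewrite normrM gtr0_norm ?invr_gt0// mulrC ler_pdivrMr//.
have cfl : continuous (f \- l) by move=> t; apply: cvgB; [exact: cf|exact: cl].
apply: le_trans (le_normr_Rintegral _ _) _ => //; first exact: cint.
apply: (@le_trans _ _ (\int[mu]_(t in `[p, q]) K)).
  apply: le_Rintegral => //.
  - apply: (cint (fun t => `|f t - l t|)) => t.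
    by apply: cvg_norm; exact: cfl.
  - by apply: cint => t; exact: cvg_cst.
  - move=> t /=; rewrite in_itv/= => /hK; rewrite /l.
    by rewrite opprD addrA.
rewrite Rintegral_cst//= lebesgue_measure_itv/= lte_fin pq.
by rewrite -EFinB.
Qed.

(* Used with s = k - w x and y = w (t - x), for t in the k-th averaging
   interval: then y lies between s + a_k and s + b_k. *)
Lemma quadratic_error_bound (R : realType) (e C B s w y : R) :
  0 <= e -> 0 <= C -> 0 <= B -> 0 < w -> `|y| <= `|s| + B ->
  e * `|y / w| + C * (y / w) ^+ 2 <=
    2 * (1 + B) ^+ 2 * (e / w + C / w ^+ 2) * (1 + s ^+ 2).
Proof.
move=> e0 C0 B0 w0 ysB.
have s0 := normr_ge0 s; have y0 := normr_ge0 y.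
rewrite normrM normfV (gtr0_norm w0) expr_div_n.
rewrite -(real_normK (num_real s)) -(real_normK (num_real y)).
set S := `|s| in s0 ysB *; set Y := `|y| in y0 ysB *.
(* [P] dominates [Y] and is at least 1, so P^2 bounds both [Y] and Y^2; finally (1 + S)^2 <= 2 (1 +
   S^2). *)
pose P := (1 + B) * (1 + S).
have P1 : 1 <= P by rewrite /P; nra.
have YP : Y <= P by apply: le_trans ysB _; rewrite /P; nra.
have hP : P ^+ 2 <= 2 * (1 + B) ^+ 2 * (1 + S ^+ 2).
  rewrite /P exprMn [2 * _]mulrC -[leRHS]mulrA ler_wpM2l ?sqr_ge0//.
  by have := sqr_ge0 (1 - S); rewrite !expr2; lra.
have hY2 : Y ^+ 2 <= 2 * (1 + B) ^+ 2 * (1 + S ^+ 2).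
  apply: le_trans hP; rewrite ler_sqr ?nnegrE//.
  exact: le_trans P1.
have hY : Y <= 2 * (1 + B) ^+ 2 * (1 + S ^+ 2).
  by apply: le_trans hP; rewrite (le_trans YP)// ler_eXnr.
rewrite (_ : 2 * _ * _ * _ =
  (e / w) * (2 * (1 + B) ^+ 2 * (1 + S ^+ 2)) +
  (C / w ^+ 2) * (2 * (1 + B) ^+ 2 * (1 + S ^+ 2))); last by ring.
rewrite mulrCA [C * _]mulrCA [Y * _]mulrC [Y ^+ 2 * _]mulrC.
by apply: lerD; rewrite ler_wpM2l// divr_ge0// ?exprn_ge0// ltW.
Qed.

(** * Quantitative estimate and passage to the limit *)

(** The bound holds for every w > 0 with [M] and [B] independent of [e], so [e] can be fixed first
    and [w] sent to infinity afterwards, [C] depending on [e] alone. *)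
Lemma kantorovich_estimate (R : realType) (phi f : R -> R) (a b : int -> R)
    (alpha B x d e C M w : R) :
  (forall u : R, has_zsum (fun k : int => phi (u - k%:~R)) 1) ->
  (forall u : R, has_zsum (fun k : int => phi (u - k%:~R) * (k%:~R - u)) 0) ->
  (forall (u : R) (s : seq int), uniq s ->
    \sum_(k <- s) `|phi (u - k%:~R)| * (1 + (k%:~R - u) ^+ 2) <= M) ->
  (forall k, a k < b k) -> (forall k, a k + b k = alpha) ->
  0 <= B -> (forall k, `|a k| <= B) -> (forall k, `|b k| <= B) ->
  continuous f -> 0 <= e -> 0 <= C ->
  (forall t, `|f t - f x - d * (t - x)| <=
    e * `|t - x| + C * (t - x) ^+ 2) ->
  0 < w ->
  `|alpha / 2 * d - w * (kantorovich phi a b w f x - f x)| <=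
    4 * (1 + B) ^+ 2 * M * (e + C / w).
Proof.
move=> phi0 phi1 phiM ab abD B0 aB bB cf e0 C0 fx w0.
have wn0 : w != 0 := lt0r_neq0 w0.
set u := w * x.
pose E := 2 * (1 + B) ^+ 2 * (e / w + C / w ^+ 2).
have E0 : 0 <= E.
  by rewrite mulr_ge0 ?mulr_ge0 ?sqr_ge0// addr_ge0// divr_ge0 ?exprn_ge0// ltW.
pose I k := \int[lebesgue_measure]_(t in
  `[(k%:~R + a k) / w, (k%:~R + b k) / w]) f t.
pose c (k : int) := w / (b k - a k) * phi (u - k%:~R) * I k.
(* The affine part of the k-th term, split along the two sums whose values are known, 1 and 0. *)
pose lin (k : int) := (f x + d * (alpha / 2 / w)) * phi (u - k%:~R) +
  d / w * (phi (u - k%:~R) * (k%:~R - u)).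
have linS : has_zsum lin
    ((f x + d * (alpha / 2 / w)) * 1 + d / w * 0).
  by apply: has_zsumD; apply: has_zsumZ; [exact: phi0|exact: phi1].
have remB k : `|c k - lin k| <=
    E * (`|phi (u - k%:~R)| * (1 + (k%:~R - u) ^+ 2)).
  set p := (k%:~R + a k) / w; set q := (k%:~R + b k) / w.
  have ba0 : b k - a k != 0 by rewrite subr_eq0 gt_eqF.
  have pq : p < q by rewrite ltr_pM2r ?invr_gt0// ltrD2l.
  (* Here q - p = (b_k - a_k) / w, and the midpoint of the interval is (k + alpha / 2) / w. *)
  have -> : c k - lin k = phi (u - k%:~R) *
      ((q - p)^-1 * I k - (f x + d * ((p + q) / 2 - x))).
    rewrite /c /lin /p /q /u -(abD k); field.
    by rewrite wn0 opprD addrACA subrr add0r ba0.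
  rewrite normrM mulrCA ler_wpM2l//.
  apply: itv_average_bound => // t /andP[pt tq].
  apply: le_trans (fx t) _.
  have -> : t - x = (w * t - u) / w by rewrite /u; field.
  apply: quadratic_error_bound => //.
  rewrite ler_pdivrMr// in pt; rewrite ler_pdivlMr// in tq.
  have := aB k; have := bB k; rewrite !ler_norml => /andP[_ bk] /andP[ak _].
  have := ler_norm (k%:~R - u); have := ler_norm (- (k%:~R - u)).
  rewrite normrN => h1 h2; apply/andP; split; lra.
have [l remS lM] : exists2 l, has_zsum (fun k => c k - lin k) l &
    `|l| <= E * M + E * M.
  apply: dominated_has_zsum remB _ => s us.
  by rewrite -mulr_sumr ler_wpM2l// phiM.
(* Adding the affine series back yields both the convergence and the value of the Kantorovich
   series. *)
have /(has_zsumD linS) {remS} := remS.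
under [X in has_zsum X _]eq_fun do rewrite addrC subrK.
rewrite mulr1 mulr0 addr0 => -[_ _ cE].
rewrite /kantorovich cE.
have -> : alpha / 2 * d - w * (f x + d * (alpha / 2 / w) + l - f x) = - (w * l).
  by field.
rewrite normrN normrM (gtr0_norm w0).
apply: le_trans (ler_wpM2l (ltW w0) lM) _.
rewrite le_eqVlt; apply/orP; left; apply/eqP.
by rewrite /E; field.
Qed.

Lemma unif_continuous_continuous (U V : uniformType) (f : U -> V) :
  unif_continuous f -> continuous f.
Proof.
move=> uf t; apply/cvg_app_entourageP => E /uf fE.
by apply: filterS (nbhs_entourage t fE) => s /xsectionP.
Qed.

Unset Implicit Arguments.
Set Strict Implicit.

Theorem theorem2p1 (R : realType) (phi : R -> R)
  (phiC : UCB phi)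
  (phi_sum : forall u : R, has_zsum (fun k : int => phi (u - k%:~R)) 1)
  (phi_moment2 : (abs_moment 2 phi < +oo)%E)
  (phi_tail : forall e : R, 0 < e ->
    \forall r \near +oo, forall u : R, (moment2_tail phi r u < e%:E)%E)
  (phi_moment1 : forall u : R,
    has_zsum (fun k : int => phi (u - k%:~R) * (k%:~R - u)) 0)
  (a b : int -> R)
  (a_bounded : bounded_fun a)
  (b_bounded : bounded_fun b)
  (alpha Delta : R)
  (Delta_gt0 : 0 < Delta)
  (abD : forall k : int, a k + b k = alpha)
  (abB : forall k : int, Delta < b k - a k)
  (f : R -> R)
  (fC : UCB f)
  (x : R)
  (dfx : derivable f x 1) :
  w * (kantorovich phi a b w f x - f x) @[w --> +oo] -->
    alpha / 2 * (f^`())%classic x.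
Proof.
case: phiC => _ bphi; case: fC => uf bf.
have [M M0 phiM] := moment02_bounded bphi phi_moment2.
have [A A0 aA] := bounded_fun_le a_bounded.
have [B B0 bB] := bounded_fun_le b_bounded.
(* A + B is a common bound for both sequences. *)
pose Q := 4 * (1 + (A + B)) ^+ 2 * M.
have Q0 : 0 <= Q by rewrite mulr_ge0// mulr_ge0// sqr_ge0.
apply/cvgrPdist_le => eps eps0.
(* The 2 leaves room for C / w <= e, and Q + 1 is positive even when Q = 0. *)
pose e := eps / (2 * (Q + 1)).
have e0 : 0 < e by rewrite divr_gt0// mulr_gt0// ltr_wpDl.
have [C C0 fx] := derivable_quadratic_bound bf dfx e0.
near=> w.
have w0 : 0 < w by near: w; exact: nbhs_pinfty_gt.
apply: (@le_trans _ _ (Q * (e + C / w))).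
  apply: (kantorovich_estimate phi_sum phi_moment1 phiM) fx w0 => //.
  - by move=> k; rewrite -subr_gt0 (lt_trans Delta_gt0).
  - exact: addr_ge0.
  - by move=> k; rewrite (le_trans (aA k))// lerDl.
  - by move=> k; rewrite (le_trans (bB k))// lerDr.
  - exact: unif_continuous_continuous uf.
  - exact: ltW.
(* This holds as soon as w >= C / e. *)
have Cwe : C / w <= e.
  by rewrite ler_pdivrMr// mulrC -ler_pdivrMr.
apply: (@le_trans _ _ (Q * (2 * e))).
  by rewrite ler_wpM2l// mulrDl mul1r lerD2l.
have -> : Q * (2 * e) = eps * (Q / (Q + 1)).
  by rewrite /e; field; rewrite lt0r_neq0// ltr_wpDl.
rewrite ler_piMr ?(ltW eps0)// ler_pdivrMr ?mul1r ?lerDl//.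
by rewrite ltr_wpDl.
Unshelve. all: by end_near. Qed.
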